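(* $B$-translation is an embedding of $\mathbf{L_1}$ in the provability logic $\mathbf{PrL}$; that is, for every formula $\phi$ of $\mathbf{L_1}$, $\vdash_{\mathbf{L_1}}\phi$ if and only if $\vdash_{\mathbf{PrL}}B(\phi)$.
   Context: The system $\mathbf{L_1}$ (Leśniewski's propositional ontology): fix a countably infinite set of name variables. The atomic formulas are exactly the expressions $\epsilon ab$ with $a,b$ name variables (possibly equal); formulas are built from atomic formulas by $\vee$ and $\neg$, the other connectives being the usual classical abbreviations. $\mathbf{L_1}$ is a Hilbert-style system of classical propositional logic (with modus ponens) over these formulas with the additional axiom schemata, for all name variables $a,b,c$: (Ax1) $\epsilon ab \supset \epsilon aa$; (Ax2) $(\epsilon ab \wedge \epsilon bc) \supset \epsilon ac$; (Ax3) $(\epsilon ab \wedge \epsilon bc) \supset \epsilon ba$. $B$-translation: to each name variable $a$ corresponds a propositional variable $p_a$, with distinct name variables corresponding to distinct propositional variables. $B$ maps formulas of $\mathbf{L_1}$ to propositional modal formulas by $B(\phi\vee\psi)=B(\phi)\vee B(\psi)$, $B(\neg\phi)=\neg B(\phi)$, $B(\epsilon ab)=p_a\wedge\Box(p_a\supset p_b)\wedge\bigl(p_b\supset\Box(p_b\supset p_a)\bigr)$. $\mathbf{PrL}$ (also called $\mathbf{GL}$) is $\mathbf{K}+\Box(\Box\phi\supset\phi)\supset\Box\phi$, i.e. the smallest normal modal logic (containing $\mathbf{K}$, closed under modus ponens, substitution and necessitation) containing this schema. *)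

(* Defs.v *)
From mathcomp Require Import all_boot.
Set Implicit Arguments.
Unset Strict Implicit.
Unset Printing Implicit Defensive.

Definition name_var := nat.
Definition prop_var := nat.

Inductive lform : Type :=
| LEps of name_var & name_var
| LOr of lform & lform
| LNeg of lform.

Definition LImp (f g : lform) : lform := LOr (LNeg f) g.
Definition LAnd (f g : lform) : lform := LNeg (LOr (LNeg f) (LNeg g)).

Inductive mform : Type :=
| MVar of prop_var
| MOr of mform & mform
| MNeg of mform
| MBox of mform.

Definition MImp (f g : mform) : mform := MOr (MNeg f) g.
Definition MAnd (f g : mform) : mform := MNeg (MOr (MNeg f) (MNeg g)).

(* The Hilbert-Ackermann axiom schemata: together with modus ponens they
   axiomatize classical propositional logic over disjunction and negation,
   [imp f g] standing for [or (neg f) g]. They are stated for an arbitrary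
   type of formulas so that both languages below use the same ones. *)
Inductive cpl_axiom (F : Type) (or imp : F -> F -> F) : F -> Prop :=
| cpl_idem f : cpl_axiom or imp (imp (or f f) f)
| cpl_add f g : cpl_axiom or imp (imp f (or f g))
| cpl_perm f g : cpl_axiom or imp (imp (or f g) (or g f))
| cpl_sum f g h :
    cpl_axiom or imp (imp (imp f g) (imp (or h f) (or h g))).

Inductive L1 : lform -> Prop :=
| L1_cpl f : cpl_axiom LOr LImp f -> L1 f
| L1_ax1 a b : L1 (LImp (LEps a b) (LEps a a))
| L1_ax2 a b c : L1 (LImp (LAnd (LEps a b) (LEps b c)) (LEps a c))
| L1_ax3 a b c : L1 (LImp (LAnd (LEps a b) (LEps b c)) (LEps b a))
| L1_mp f g : L1 (LImp f g) -> L1 f -> L1 g.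

Fixpoint msubst (s : prop_var -> mform) (f : mform) : mform :=
  match f with
  | MVar v => s v
  | MOr g h => MOr (msubst s g) (msubst s h)
  | MNeg g => MNeg (msubst s g)
  | MBox g => MBox (msubst s g)
  end.

(* [K_plus Ax] is the smallest normal modal logic containing [Ax]. *)
Inductive K_plus (Ax : mform -> Prop) : mform -> Prop :=
| K_cpl f : cpl_axiom MOr MImp f -> K_plus Ax f
| K_dist f g :
    K_plus Ax (MImp (MBox (MImp f g)) (MImp (MBox f) (MBox g)))
| K_ax f : Ax f -> K_plus Ax f
| K_mp f g : K_plus Ax (MImp f g) -> K_plus Ax f -> K_plus Ax g
| K_subst s f : K_plus Ax f -> K_plus Ax (msubst s f)
| K_nec f : K_plus Ax f -> K_plus Ax (MBox f).

Inductive lob_axiom : mform -> Prop :=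
| lob f : lob_axiom (MImp (MBox (MImp (MBox f) f)) (MBox f)).

Definition PrL : mform -> Prop := K_plus lob_axiom.

Fixpoint Btrans (p : name_var -> prop_var) (f : lform) : mform :=
  match f with
  | LEps a b =>
      let pa := MVar (p a) in
      let pb := MVar (p b) in
      MAnd (MAnd pa (MBox (MImp pa pb))) (MImp pb (MBox (MImp pb pa)))
  | LOr g h => MOr (Btrans p g) (Btrans p h)
  | LNeg g => MNeg (Btrans p g)
  end.

(* Main.v *)
(** Left to right, the translations of the three axioms are derivable already
in K. Right to left, suppose [B(phi)] is a theorem of PrL, and let [e] be a
classical valuation of the atoms [eps a b] satisfying the axioms of L1 for the
names occurring in [phi]. Then [D = {a | e a a}] carries the equivalence
relation [e]. Take the irreflexive Kripke model in which the root sees exactly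
one dead end for each element of [D], with [p_b] true at the root iff [e b b]
and at the dead end [d] iff [e d b]. This is a model of PrL whose root
satisfies [B(eps a b)] iff [e a b], so [e] satisfies [phi]. Hence [phi] is a
tautological consequence of finitely many axioms of L1. *)

Require Import Defs.
From mathcomp Require Import all_boot.

Set Implicit Arguments.
Unset Strict Implicit.
Unset Printing Implicit Defensive.

(** * Propositional calculus from the Hilbert-Ackermann schemata *)

Section Theories.

Variables (F : Type) (or : F -> F -> F) (neg : F -> F).

Local Notation "f ~> g" := (or (neg f) g) (at level 60, right associativity).

(** Stated for any set of formulas over any language, so that it covers [L1], [K_plus Ax] and their
    extensions by hypotheses. *)
Record theory (T : F -> Prop) : Prop := Theory {
  theory_cpl : forall f, cpl_axiom or (fun f g => f ~> g) f -> T f;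
  theory_mp : forall f g, T (f ~> g) -> T f -> T g }.

Section Rules.

Variable T : F -> Prop.
Hypothesis thT : theory T.

Let mp f g : T (f ~> g) -> T f -> T g := @theory_mp T thT f g.

Lemma theory_idem f : T (or f f ~> f).
Proof. exact: (theory_cpl thT (cpl_idem _ _ f)). Qed.

Lemma theory_add f g : T (f ~> or f g).
Proof. exact: (theory_cpl thT (cpl_add _ _ f g)). Qed.

Lemma theory_perm f g : T (or f g ~> or g f).
Proof. exact: (theory_cpl thT (cpl_perm _ _ f g)). Qed.

Lemma theory_sum f g h : T (f ~> g) -> T (or h f ~> or h g).
Proof. exact: mp (theory_cpl thT (cpl_sum or (fun f g => f ~> g) f g h)). Qed.

Lemma theory_syll f g h : T (f ~> g) -> T (g ~> h) -> T (f ~> h).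
Proof. by move=> fg gh; apply: mp fg; apply: theory_sum. Qed.

Lemma theory_refl f : T (f ~> f).
Proof. exact: theory_syll (theory_add f f) (theory_idem f). Qed.

Lemma theory_addr f g : T (g ~> or f g).
Proof. exact: theory_syll (theory_add g f) (theory_perm g f). Qed.

Lemma theory_orP f g h : T (f ~> h) -> T (g ~> h) -> T (or f g ~> h).
Proof.
move=> fh gh; apply: theory_syll (theory_idem h).
apply: theory_syll (theory_sum h fh).
exact: theory_syll (theory_sum f gh) (theory_perm f h).
Qed.

Lemma theory_orCA f g h : T (or f (or g h) ~> or g (or f h)).
Proof.
apply: theory_orP; last exact/theory_sum/theory_addr.
exact: theory_syll (theory_add f h) (theory_addr g _).
Qed.

Lemma theory_contract f g : T (f ~> f ~> g) -> T (f ~> g).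
Proof. by apply: mp; apply: theory_orP (theory_add _ _) (theory_refl _). Qed.

Lemma theory_mp_under f g h : T (f ~> g ~> h) -> T (f ~> g) -> T (f ~> h).
Proof.
move=> fgh fg; apply: theory_contract; apply: theory_syll fg _.
exact: mp (theory_orCA _ _ _) fgh.
Qed.

Lemma theory_cases f g : T (f ~> g) -> T (neg f ~> g) -> T g.
Proof. by move=> fg nfg; apply: mp (theory_orP nfg fg) (theory_refl f). Qed.

Lemma theory_negneg f : T f -> T (neg (neg f)).
Proof. exact: mp (mp (theory_perm _ _) (theory_refl (neg f))). Qed.

Lemma theory_orl f g : T f -> T (or f g).
Proof. exact: mp (theory_add _ _). Qed.

Lemma theory_orr f g : T g -> T (or f g).
Proof. exact: mp (theory_addr _ _). Qed.

Lemma theory_negor f g : T (neg f) -> T (neg g) -> T (neg (or f g)).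
Proof.
move=> nf ng; apply: (theory_cases (f := or f g)); last exact: theory_refl.
by apply: theory_orP; apply: theory_orl.
Qed.

(* The deduction theorem: the formulas derivable from [T] and [f] are those
   [g] with [T (f ~> g)]. *)
Lemma theory_extend f : theory (fun g => T (f ~> g)).
Proof.
split=> [g g_ax|g h]; last exact: theory_mp_under.
exact: theory_orr (theory_cpl thT g_ax).
Qed.

End Rules.

End Theories.

(** * Completeness of the calculus for tautologies and finite consequence *)

Inductive pform (A : Type) : Type :=
| PAtom of A
| POr of pform A & pform A
| PNeg of pform A.

Definition PImp A (f g : pform A) : pform A := POr (PNeg f) g.
Definition PAnd A (f g : pform A) : pform A := PNeg (POr (PNeg f) (PNeg g)).

Fixpoint peval A (v : A -> bool) (f : pform A) : bool :=
  match f with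
  | PAtom a => v a
  | POr g h => peval v g || peval v h
  | PNeg g => ~~ peval v g
  end.

Fixpoint patoms A (f : pform A) : seq A :=
  match f with
  | PAtom a => [:: a]
  | POr g h => patoms g ++ patoms h
  | PNeg g => patoms g
  end.

Section Completeness.

Variables (F : Type) (or : F -> F -> F) (neg : F -> F).
Variables (A : eqType) (s : A -> F).

Fixpoint pinterp (f : pform A) : F :=
  match f with
  | PAtom a => s a
  | POr g h => or (pinterp g) (pinterp h)
  | PNeg g => neg (pinterp g)
  end.

Definition signed (b : bool) (f : F) : F := if b then f else neg f.

(** Kalmár's lemma: once the atoms are decided according to [v], so is every compound. *)
Lemma theory_decides T v f : theory or neg T ->
  {in patoms f, forall a, T (signed (v a) (s a))} ->
  T (signed (peval v f) (pinterp f)).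
Proof.
move=> thT; elim: f => [a|g IHg h IHh|g IHg] /= dec_v.
- by apply: dec_v; rewrite mem_head.
- have {IHg} : T (signed (peval v g) (pinterp g)).
    by apply: IHg => a ga; apply: dec_v; rewrite mem_cat ga.
  have {IHh dec_v} : T (signed (peval v h) (pinterp h)).
    by apply: IHh => a ha; apply: dec_v; rewrite mem_cat ha orbT.
  case: (peval v g) (peval v h) => [] [] /= Th Tg.
  + exact: (theory_orl thT).
  + exact: (theory_orl thT).
  + exact: (theory_orr thT).
  + exact: (theory_negor thT).
- by have := IHg dec_v; case: (peval v g) => //=; apply: (theory_negneg thT).
Qed.

Lemma tautology_theory T f : theory or neg T ->
  (forall v, peval v f) -> T (pinterp f).
Proof.
move=> thT taut_f.
(* The list [l] holds the atoms still undecided; [T] varies in the induction, since each case split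
   adds a literal to it as a hypothesis. *)
have split_atoms (l : seq A) v : {in patoms f, forall a, a \notin l ->
    T (signed (v a) (s a))} -> T (pinterp f).
  elim: l v T thT => [|a l IHl] v T thT dec_v.
    by have := theory_decides thT (fun a fa => dec_v a fa isT); rewrite taut_f.
  have ext b : T (or (neg (signed b (s a))) (pinterp f)).
    apply: (IHl (fun c => if c == a then b else v c) _ (theory_extend thT _)).
    move=> c fc lc; case: eqP => [->|/eqP neq_ca].
      exact: (theory_refl thT).
    by apply: (theory_orr thT); apply: dec_v; rewrite // inE negb_or neq_ca.
  exact: (theory_cases thT (ext true) (ext false)).
(* All atoms start undecided, so the initial valuation is arbitrary. *)
by apply: (split_atoms (patoms f) xpredT) => a ->.
Qed.

(** Moving the premises one by one into the antecedent of [f] leaves a tautology. *)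
Lemma consequence_theory T (I : eqType) (r : seq I) (G : I -> pform A) f :
  theory or neg T ->
  (forall v, {in r, forall i, peval v (G i)} -> peval v f) ->
  {in r, forall i, T (pinterp (G i))} -> T (pinterp f).
Proof.
move=> thT; elim: r f => [|i r IHr] f cons_f thG.
  by apply: tautology_theory => // v; apply: cons_f.
have := thG i (mem_head i r); apply: (theory_mp thT).
apply: (IHr (PImp (G i) f)) => [|j rj]; last by apply: thG; rewrite inE rj orbT.
move=> v Gr /=; case Gi: (peval v (G i)) => //=; apply: cons_f => j.
by rewrite inE => /predU1P[-> // | /Gr].
Qed.

End Completeness.

(** * Soundness of the translation in every normal modal logic *)

Lemma K_plus_theory Ax : theory MOr MNeg (K_plus Ax).
Proof. by split=> [f /K_cpl|f g /K_mp]; [|apply]. Qed.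

Lemma L1_theory : theory LOr LNeg L1.
Proof. by split=> [f /L1_cpl|f g /L1_mp]; [|apply]. Qed.

Lemma K_plus_box_trans Ax f g h :
  K_plus Ax (MImp (MBox (MImp f g))
                  (MImp (MBox (MImp g h)) (MBox (MImp f h)))).
Proof.
have th := K_plus_theory Ax.
apply: (theory_syll th) (K_dist _ _ _).
apply: K_mp (K_dist _ _ _) (K_nec _).
pose P i : pform nat := PAtom i.
apply: (tautology_theory (nth f [:: f; g; h])
  (f := PImp (PImp (P 0) (P 1)) (PImp (PImp (P 1) (P 2)) (PImp (P 0) (P 2))))
  th) => v /=.
by case: (v 0) (v 1) (v 2) => [] [] [].
Qed.

Section Translation.

Variable p : name_var -> prop_var.

(* Propositional skeleton of [B(eps a b)], over atoms standing for [p_a],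
   [p_b], [box (p_a -> p_b)] and [box (p_b -> p_a)]. *)
Let skel (pa pb ab ba : nat) : pform nat :=
  PAnd (PAnd (PAtom pa) (PAtom ab)) (PImp (PAtom pb) (PAtom ba)).

(** With boxed implications taken as atoms, Ax1 follows from the reflexivity of strict implication,
    Ax2 from its transitivity, and Ax3 is a tautology. *)
Lemma Btrans_sound Ax phi : L1 phi -> K_plus Ax (Btrans p phi).
Proof.
have th := K_plus_theory Ax.
have id_box a : K_plus Ax (MBox (MImp (MVar (p a)) (MVar (p a)))).
  exact: K_nec (theory_refl th _).
elim=> {phi} [f f_ax|a b|a b c|a b c|f g _ + _]; last exact: K_mp.
- apply: K_cpl; case: f_ax => *.
  + exact: cpl_idem.
  + exact: cpl_add.
  + exact: cpl_perm.
  + exact: cpl_sum.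
- pose box x y := MBox (MImp (MVar (p x)) (MVar (p y))).
  pose s := nth (MVar 0) [:: MVar (p a); MVar (p b); box a b; box b a; box a a].
  apply: (consequence_theory (s := s) (r := [:: tt]) (G := fun=> PAtom 4)
    (f := PImp (skel 0 1 2 3) (skel 0 0 4 4)) th) => [v /(_ tt isT) /=|_ _].
    by case: (v 0) (v 1) (v 2) (v 3) (v 4) => [] [] [] [] [].
  exact: id_box.
- pose box x y := MBox (MImp (MVar (p x)) (MVar (p y))).
  pose s := nth (MVar 0) [:: MVar (p a); MVar (p b); MVar (p c);
    box a b; box b a; box b c; box c b; box a c; box c a].
  (* Transitivity along a, b, c and, for the converse boxes, along c, b, a. *)
  pose G (fwd : bool) : pform nat :=
    if fwd then PImp (PAtom 3) (PImp (PAtom 5) (PAtom 7))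
    else PImp (PAtom 6) (PImp (PAtom 4) (PAtom 8)).
  apply: (consequence_theory (s := s) (r := [:: true; false]) (G := G)
    (f := PImp (PAnd (skel 0 1 3 4) (skel 1 2 5 6)) (skel 0 2 7 8)) th).
    move=> v Gv; move: (Gv true isT) (Gv false isT) => /=.
    case: (v 0) (v 1) (v 2) => [] [] [] //;
      by case: (v 3) (v 4) (v 5) (v 6) (v 7) (v 8) => [] [] [] [] [] [].
  by case=> _ /=; apply: K_plus_box_trans.
- pose box x y := MBox (MImp (MVar (p x)) (MVar (p y))).
  pose s := nth (MVar 0) [:: MVar (p a); MVar (p b); MVar (p c);
    box a b; box b a; box b c; box c b].
  apply: (tautology_theory s
    (f := PImp (PAnd (skel 0 1 3 4) (skel 1 2 5 6)) (skel 1 0 4 3)) th).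
  move=> v /=.
  case: (v 0) (v 1) (v 2) => [] [] [] //;
    by case: (v 3) (v 4) (v 5) (v 6) => [] [] [] [].
Qed.

End Translation.

(** * Fan-shaped Kripke models of the provability logic *)

(* Truth in the model with root [None] seeing exactly the dead ends [Some d],
   for [d] in [D]. *)
Fixpoint fan_force (W : Type) (D : seq W) (V : option W -> prop_var -> bool)
    (x : option W) (f : mform) : bool :=
  match f with
  | MVar q => V x q
  | MOr g h => fan_force D V x g || fan_force D V x h
  | MNeg g => ~~ fan_force D V x g
  | MBox g => if x is None then all (fun d => fan_force D V (Some d) g) D
              else true
  end.

Lemma fan_force_subst W (D : seq W) V x s f :
  fan_force D V x (msubst s f) =
    fan_force D (fun y q => fan_force D V y (s q)) x f.
Proof.
elim: f x => //= [g IHg h IHh|g IHg|g IHg] x; rewrite ?IHg ?IHh //.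
by case: x => //; apply: eq_all => d; rewrite IHg.
Qed.

(** The induction needs all [V] for the substitution rule and all [x] for necessitation. *)
Lemma PrL_fan_sound W (D : seq W) V x f : PrL f -> fan_force D V x f.
Proof.
move=> Lf; elim: Lf V x => {f}.
- move=> f f_ax V x; case: f_ax => [g|g h|g h|g h k] /=.
  + by case: (fan_force D V x g).
  + by case: (fan_force D V x g).
  + by case: (fan_force D V x g); case: (fan_force D V x h).
  + by case: (fan_force D V x g); case: (fan_force D V x h);
       case: (fan_force D V x k).
- move=> f g V [d|] //=.
  have all_mp (P Q : pred W) E :
      [|| ~~ all (fun d => ~~ P d || Q d) E, ~~ all P E | all Q E].
    by elim: E => //= d E; case: (P d) (Q d) => [] [] //=; rewrite orbT.
  exact: all_mp.
(* Boxes are true at dead ends, so at the root the premise of Löb's axiom reduces to its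
   conclusion. *)
- by move=> _ [f] V [d|] //=; rewrite orNb.
- by move=> f g _ IHfg _ IHf V x; have := IHfg V x; rewrite /= IHf.
- by move=> s f _ IHf V x; rewrite fan_force_subst.
- move=> f _ IHf V [d|] //=; rewrite (eq_all (a2 := predT)) ?all_predT // => d.
  exact: IHf.
Qed.

(** * Faithfulness of the translation *)

Fixpoint lskel (f : lform) : pform (name_var * name_var) :=
  match f with
  | LEps a b => PAtom (a, b)
  | LOr g h => POr (lskel g) (lskel h)
  | LNeg g => PNeg (lskel g)
  end.

Lemma lskelK f : pinterp LOr LNeg (fun ab => LEps ab.1 ab.2) (lskel f) = f.
Proof. by elim: f => //= [g -> h ->|g ->]. Qed.

Fixpoint lnames (f : lform) : seq name_var :=
  match f with
  | LEps a b => [:: a; b]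
  | LOr g h => lnames g ++ lnames h
  | LNeg g => lnames g
  end.

Section FanModel.

Variables (p : name_var -> prop_var) (N : seq name_var) (e : rel name_var).
Hypothesis p_inj : injective p.
Hypothesis e_ax1 : {in N &, forall a b, e a b -> e a a}.
Hypothesis e_ax2 : {in N & &, forall a b c, e a b -> e b c -> e a c}.
Hypothesis e_ax3 : {in N & &, forall a b c, e a b -> e b c -> e b a}.

Let D := [seq a <- N | e a a].
(** A search through [N] plays the part of an inverse of [p]; [odflt b x] yields [e b b] at the root
    and [e d b] at the dead end [d]. *)
Let V (x : option name_var) (q : prop_var) : bool :=
  has (fun b => (p b == q) && e (odflt b x) b) N.

Let fan_var x b : b \in N -> V x (p b) = e (odflt b x) b.
Proof.
move=> Nb; apply/hasP/idP => [[c _ /andP[/eqP/p_inj -> //]]|e_b].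
by exists b; rewrite // eqxx.
Qed.

Let fan_box a b : a \in N -> b \in N ->
  fan_force D V None (MBox (MImp (MVar (p a)) (MVar (p b)))) =
    all (fun d => e d a ==> e d b) D.
Proof.
by move=> Na Nb; apply: eq_all => d; rewrite /= !fan_var // implybE.
Qed.

(** Since [e a a] puts [a] in [D], taking [d = a] gives [e a b]; the converse is Ax2. *)
Let fan_box_eps a b : a \in N -> b \in N -> e a a ->
  all (fun d => e d a ==> e d b) D = e a b.
Proof.
move=> Na Nb e_aa; apply/allP/idP => [sub_ab|e_ab d].
  by have := sub_ab a; rewrite mem_filter e_aa Na => /(_ isT).
by rewrite mem_filter => /andP[_ Nd]; apply/implyP => /e_ax2; apply.
Qed.

(** Without [e a a] both sides fail, by Ax1. Otherwise the first box amounts to [e a b], and the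
    last conjunct then follows from Ax3 for a, b, b. *)
Let fan_eps a b : a \in N -> b \in N ->
  fan_force D V None (Btrans p (LEps a b)) = e a b.
Proof.
move=> Na Nb.
transitivity ((e a a && all (fun d => e d a ==> e d b) D) &&
              (e b b ==> all (fun d => e d b ==> e d a) D)).
  rewrite -!fan_box // -[e a a](fan_var None Na) -[e b b](fan_var None Nb).
  rewrite /=; case: (V None (p a)) (V None (p b)) => [] [] //=;
    by case: (all _ D) => //; case: (all _ D).
case e_aa: (e a a) => /=; last by apply/esym/negP => /e_ax1; rewrite e_aa; auto.
rewrite fan_box_eps //; case e_ab: (e a b) => //=.
apply/implyP => e_bb; rewrite fan_box_eps //.
exact: e_ax3 e_ab e_bb.
Qed.

Lemma fan_force_Btrans phi : {subset lnames phi <= N} ->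
  fan_force D V None (Btrans p phi) = peval (fun ab => e ab.1 ab.2) (lskel phi).
Proof.
elim: phi => [a b|f IHf g IHg|f IHf] subN.
- by apply: fan_eps; apply: subN; rewrite !inE eqxx ?orbT.
- by rewrite /= IHf ?IHg // => a fa; apply: subN; rewrite mem_cat fa ?orbT.
- by rewrite /= IHf.
Qed.

Lemma PrL_Btrans_eval phi : {subset lnames phi <= N} -> PrL (Btrans p phi) ->
  peval (fun ab => e ab.1 ab.2) (lskel phi).
Proof. by move=> subN L_phi; rewrite -fan_force_Btrans // PrL_fan_sound. Qed.

End FanModel.

(** A single index type for the three schemata lets a finite list of indices serve as the premises
    of [consequence_theory]. *)
Definition L1_axiom (i : nat * (name_var * name_var * name_var)) : lform :=
  let: (k, (a, b, c)) := i in
  match k with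
  | 0 => LImp (LEps a b) (LEps a a)
  | 1 => LImp (LAnd (LEps a b) (LEps b c)) (LEps a c)
  | _ => LImp (LAnd (LEps a b) (LEps b c)) (LEps b a)
  end.

Lemma L1_axiomP i : L1 (L1_axiom i).
Proof.
by case: i => [[|[|k]] [[a b] c]];
  [apply: L1_ax1 | apply: L1_ax2 | apply: L1_ax3].
Qed.

Lemma Btrans_faithful p phi : injective p -> PrL (Btrans p phi) -> L1 phi.
Proof.
move=> p_inj L_phi; pose N := lnames phi.
pose r := [seq (k, abc) | k <- iota 0 3,
  abc <- [seq (ab, c) | ab <- [seq (a, b) | a <- N, b <- N], c <- N]].
have in_r k a b c : k < 3 -> a \in N -> b \in N -> c \in N ->
    (k, (a, b, c)) \in r.
  move=> lt_k3 Na Nb Nc; apply: allpairs_f; first by rewrite mem_iota.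
  by do 2!apply: allpairs_f => //.
rewrite -[phi]lskelK.
apply: (consequence_theory (r := r) (G := lskel \o L1_axiom) L1_theory);
  last by move=> i _; rewrite lskelK; apply: L1_axiomP.
move=> v ax_v; pose e a b := v (a, b).
have -> : peval v (lskel phi) = peval (fun ab => e ab.1 ab.2) (lskel phi).
  by elim: (phi) => [a b|f /= -> g ->|f /= ->].
apply: (PrL_Btrans_eval (N := N) p_inj) L_phi => // [a b|a b c|a b c] Na Nb.
(* Ax1 has no third name; [b] fills the slot. *)
- by have /= := ax_v _ (in_r 0 a b b isT Na Nb Nb); rewrite -implybE => /implyP.
- move=> Nc e_ab e_bc; have /= := ax_v _ (in_r 1 a b c isT Na Nb Nc).
  by rewrite -/(e a b) -/(e b c) e_ab e_bc.
- move=> Nc e_ab e_bc; have /= := ax_v _ (in_r 2 a b c isT Na Nb Nc).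
  by rewrite -/(e a b) -/(e b c) e_ab e_bc.
Qed.

Theorem corollary6p6 (p : name_var -> prop_var) (hp : injective p) (phi : lform) :
  L1 phi <-> PrL (Btrans p phi).
Proof. by split; [apply: Btrans_sound | apply: Btrans_faithful]. Qed.
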